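(* For any paired symmetric (elasticity) tensor $\mathscr{A}\in\mathbb{T}_{4,3}$, let $\mathscr{B}$ be a semi-paired symmetric tensor of $\mathscr{A}$. Suppose that $i_1i_2\cdots i_9$ and $j_1j_2\cdots j_9$ are two arbitrary permutations of $123123123$, and that $S$ is the unfolded matrix of $\mathscr{B}$ with respect to the indices $i_1i_2\cdots i_9$ and $j_1j_2\cdots j_9$. Then the matrix $S$ is symmetric. Furthermore, if $S$ is positive semidefinite, then the biquadratic form $\mathscr{A}x^2y^2$ is a sum of squares of bilinear forms; and if $S$ is positive definite, then the biquadratic form $\mathscr{A}x^2y^2$ is positive definite.
   Context: $\mathbb{T}_{4,3}$ is the set of real tensors $\mathscr{A}=(a_{ijkl})$ with $i,j,k,l\in\{1,2,3\}$. $\mathscr{A}$ is paired symmetric if $a_{ijkl}=a_{jikl}=a_{ijlk}=a_{jilk}$ for all indices; it is an elasticity tensor if moreover $a_{ijkl}=a_{klij}$ for all indices. ''Paired symmetric (elasticity) tensor'' means that the statement is made for paired symmetric tensors and likewise for elasticity tensors. For $x,y\in\mathbb{R}^3$, $\mathscr{A}x^2y^2:=\sum_{i,j,k,l=1}^3a_{ijkl}x_ix_jy_ky_l$; it is positive definite if $\mathscr{A}x^2y^2>0$ for all $x,y\in\mathbb{R}^3\setminus\{0\}$, and a sum of squares of bilinear forms if it equals $\sum_{s=1}^r\big(\sum_{i,j=1}^3\alpha^s_{ij}x_iy_j\big)^2$ identically for some $r\ge1$ and real $\alpha^s_{ij}$. A tensor $\mathscr{B}=(b_{ijkl})\in\mathbb{T}_{4,3}$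 is a semi-paired symmetric tensor of the paired symmetric tensor $\mathscr{A}$ if for all indices $b_{ijkl}=b_{jilk}$, $b_{ijlk}=b_{jikl}$ and $b_{ijkl}+b_{jilk}+b_{ijlk}+b_{jikl}=4a_{ijkl}$. A permutation of $123123123$ is a sequence of length 9 in which each of $1,2,3$ occurs three times. The unfolded matrix of $\mathscr{B}$ with respect to $i_1\cdots i_9$ and $j_1\cdots j_9$ is the $9\times9$ matrix with $(s,t)$ entry $b_{i_si_tj_sj_t}$ for $s,t\in\{1,\ldots,9\}$.
   Formalization: The sum-of-squares claim assumes the nine pairs (i_s, j_s) are distinct. Without this it fails: for i=j=123123123 and B=A with only a_1122=a_2211=-1, S=0 is positive semidefinite, but the form -(x1y2)^2-(x2y1)^2 is not a sum of squares. *)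

(* Defs.v *)
From mathcomp Require Import all_boot all_order all_algebra.
From mathcomp Require Import reals.

Set Implicit Arguments.
Unset Strict Implicit.
Unset Printing Implicit Defensive.

Import Order.TTheory GRing.Theory Num.Theory.
Local Open Scope ring_scope.

Definition tensor43 (R : Type) := 'I_3 -> 'I_3 -> 'I_3 -> 'I_3 -> R.

Definition paired_symmetric (R : realType) (A : tensor43 R) : Prop :=
  forall i j k l, [/\ A i j k l = A j i k l, A i j k l = A i j l k
                    & A i j k l = A j i l k].

Definition elasticity_tensor (R : realType) (A : tensor43 R) : Prop :=
  paired_symmetric A /\ forall i j k l, A i j k l = A k l i j.

Definition semi_paired_symmetric_of (R : realType) (A B : tensor43 R) : Prop :=
  forall i j k l,
    [/\ B i j k l = B j i l k, B i j l k = B j i k l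
      & B i j k l + B j i l k + B i j l k + B j i k l = 4 * A i j k l].

Definition biquadratic (R : realType) (A : tensor43 R) (x y : 'rV[R]_3) : R :=
  \sum_(i < 3) \sum_(j < 3) \sum_(k < 3) \sum_(l < 3)
    A i j k l * x 0 i * x 0 j * y 0 k * y 0 l.

Definition biquadratic_posdef (R : realType) (A : tensor43 R) : Prop :=
  forall x y : 'rV[R]_3, x != 0 -> y != 0 -> 0 < biquadratic A x y.

Definition sos_bilinear (R : realType) (A : tensor43 R) : Prop :=
  exists (r : nat) (alpha : 'I_r -> 'M[R]_3), (0 < r)%N /\
    forall x y : 'rV[R]_3,
      biquadratic A x y =
      \sum_(s < r) (\sum_(i < 3) \sum_(j < 3) alpha s i j * x 0 i * y 0 j) ^+ 2.

Definition perm123123123 (w : 9.-tuple 'I_3) : Prop :=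
  forall c : 'I_3, count_mem c w = 3%N.

Definition unfolded_matrix (R : realType) (B : tensor43 R)
    (i j : 9.-tuple 'I_3) : 'M[R]_9 :=
  \matrix_(s < 9, t < 9) B (tnth i s) (tnth i t) (tnth j s) (tnth j t).

(* The nine positions (i_s, j_s) are pairwise distinct, hence exhaust all pairs,
   i.e. every entry of the tensor occurs exactly once in the unfolded matrix.
   This does not follow from [perm123123123 i] and [perm123123123 j]: take
   i = j. In that case a tensor whose only nonzero entries are
   a_1122 = a_2211 = -1 unfolds to the zero matrix, although its biquadratic
   form -(x_1 y_2)^2 - (x_2 y_1)^2 is not a sum of squares. *)
Definition distinct_pairs (i j : 9.-tuple 'I_3) : Prop :=
  injective (fun s : 'I_9 => (tnth i s, tnth j s)).

(* Stated for the quadratic form only; symmetry of the matrix is separate. *)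
Definition mx_psd (R : realType) (n : nat) (S : 'M[R]_n) : Prop :=
  forall z : 'cV[R]_n, 0 <= (z^T *m S *m z) 0 0.

Definition mx_posdef (R : realType) (n : nat) (S : 'M[R]_n) : Prop :=
  forall z : 'cV[R]_n, z != 0 -> 0 < (z^T *m S *m z) 0 0.

(* Main.v *)
Require Import Defs.
From mathcomp Require Import all_boot all_order all_algebra.
From mathcomp Require Import reals.
From mathcomp Require Import ring.

(** Symmetrizing over [i <-> j] and [k <-> l] shows that [A] and [B] have the
    same biquadratic form. When the positions [(i_s, j_s)] exhaust all pairs,
    that form is [z^T S z] with [z_s = x_{i_s} y_{j_s}], so a factorization
    [S = L L^T], built from successive Schur complements, gives the sum of
    squares. A positive definite [S] cannot have two equal positions [s], [t],
    since then [e_s - e_t] would be in its kernel. *)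

Set Implicit Arguments.
Unset Strict Implicit.
Unset Printing Implicit Defensive.

Import Order.TTheory GRing.Theory Num.Theory.
Local Open Scope ring_scope.

Section PsdFactorization.
Variable R : realType.

Lemma symmetricmxP n (S : 'M[R]_n) : reflect (S^T = S) (S \is symmetricmx).
Proof.
by apply: (iffP (is_hermitianmxP _ _ _)); rewrite expr0 scale1r map_mx_id.
Qed.

(** With [w] fixed, the form becomes a quadratic polynomial in the scalar [t], so bounds follow from
    choosing [t]. *)
Lemma quad_block n (a t : R) (u : 'rV[R]_n) (C : 'M[R]_n) (w : 'cV[R]_n) :
  ((col_mx t%:M w)^T *m block_mx a%:M u u^T C *m col_mx t%:M w) 0 0 =
    a * t ^+ 2 + 2 * t * (u *m w) 0 0 + (w^T *m C *m w) 0 0.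
Proof.
rewrite tr_col_mx mul_row_block mul_row_col !mulmxDl tr_scalar_mx.
have -> : w^T *m u^T *m t%:M = t *: (u *m w).
  by rewrite mul_mx_scalar -trmx_mul [u *m w]mx11_scalar tr_scalar_mx.
rewrite !mul_scalar_mx -!scalemxAl !mxE big_ord1 !mxE !eqxx !mulr1n; ring.
Qed.

(* Schur complement, also valid at [a = 0], where [a^-1 = 0] and [u = 0]. *)
Lemma psd_block n (a : R) (u : 'rV[R]_n) (C : 'M[R]_n) :
  mx_psd (block_mx a%:M u u^T C : 'M_(1 + n)) ->
  [/\ 0 <= a, a = 0 -> u = 0 & mx_psd (C - a^-1 *: (u^T *m u))].
Proof.
move=> psdS.
have quad_ge0 t (w : 'cV[R]_n) : 0 <= a * t ^+ 2 + 2 * t * (u *m w) 0 0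
                        + (w^T *m C *m w) 0 0.
  by rewrite -quad_block.
split=> [|a0|w].
- by have := quad_ge0 1 0; rewrite !mulmx0 !mxE expr1n !mulr1 mulr0 !addr0.
- apply/rowP=> k; rewrite [RHS]mxE; apply/eqP/negP=> /negP uk0.
  pose w : 'cV[R]_n := delta_mx k 0; pose c := (w^T *m C *m w) 0 0.
  (* With [a = 0] the form is affine in [t] of slope [2 * u 0 k]; this [t] gives it the value -1. *)
  have := quad_ge0 (- (c + 1) / (2 * u 0 k)) w.
  rewrite a0 mul0r add0r -/c -colE mxE.
  have -> : 2 * (- (c + 1) / (2 * u 0 k)) * u 0 k + c = -1 by field.
  by rewrite oppr_ge0 ler10.
- rewrite mulmxBr mulmxBl -scalemxAr -scalemxAl (mulmxA w^T) -trmx_mul.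
  rewrite -(mulmxA _ u) [u *m w]mx11_scalar tr_scalar_mx -scalar_mxM.
  rewrite mxE [X in _ + X]mxE [X in - X]mxE [X in _ - _ * X]mxE mulr1n.
  (* For [a > 0] this [t] minimizes the form, and the minimum is the Schur complement evaluated at
     [w]. For [a = 0] it is 0. *)
  have := quad_ge0 (- a^-1 * (u *m w) 0 0) w.
  move: ((u *m w) 0 0) => c.
  suff -> : a * (- a^-1 * c) ^+ 2 + 2 * (- a^-1 * c) * c = - (a^-1 * (c * c)).
    by rewrite addrC.
  have [->|a0] := eqVneq a 0; first by rewrite invr0; ring.
  by field.
Qed.

(** Cholesky factorization, by induction on the size: a factor of the Schur complement is bordered
    by one new column. *)
Lemma psd_factorization n (S : 'M[R]_n) :
  S \is symmetricmx -> mx_psd S -> exists L : 'M[R]_n, S = L *m L^T.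
Proof.
elim: n S => [S _ _|n IHn]; first by exists 0; apply/matrixP=> -[].
rewrite -[n.+1]/(1 + n)%N => S /symmetricmxP symS.
rewrite -[S]submxK [ulsubmx S]mx11_scalar.
have -> : dlsubmx S = (ursubmx S)^T by rewrite -{1}symS trmx_ursub.
have: (drsubmx S)^T = drsubmx S by rewrite trmx_drsub symS.
move: (drsubmx S) (ursubmx S) (ulsubmx S 0 0) => C u a symC psdS.
have [a_ge0 u0 psdC] := psd_block psdS.
have [|L defL] := IHn _ _ psdC.
  by apply/symmetricmxP; rewrite linearB linearZ /= trmx_mul trmxK symC.
pose r := Num.sqrt a.
have rr : r * r = a by rewrite -expr2 sqr_sqrtr.
(* When [a = 0], [r * r^-1] is 0 rather than 1, but then [u] vanishes too. *)
have ru : (r * r^-1) *: u = u.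
  have [a0|a_neq0] := eqVneq a 0; first by rewrite u0 // scaler0.
  by rewrite divff ?scale1r // sqrtr_eq0 -ltNge lt_def a_neq0.
exists (block_mx r%:M 0 (r^-1 *: u^T) L).
rewrite tr_block_mx mulmx_block tr_scalar_mx trmx0 !linearZ /= trmxK.
rewrite !mul0mx !mulmx0 !addr0 -scalar_mxM rr -defL.
rewrite mul_scalar_mx mul_mx_scalar !scalerA [r^-1 * r]mulrC.
rewrite -[(r / r) *: u^T]linearZ /= ru.
by rewrite -scalemxAl scalerA -invfM rr addrC subrK.
Qed.

End PsdFactorization.

Section Biquadratic.
Variables (R : realType) (A B : tensor43 R).
Implicit Types x y : 'rV[R]_3.

Lemma biquadraticD (T U : tensor43 R) x y :
  biquadratic (fun i j k l => T i j k l + U i j k l) x y =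
  biquadratic T x y + biquadratic U x y.
Proof.
rewrite /biquadratic -big_split; apply: eq_bigr => i _.
rewrite -big_split; apply: eq_bigr => j _.
rewrite -big_split; apply: eq_bigr => k _.
by rewrite -big_split; apply: eq_bigr => l _ /=; ring.
Qed.

(** The weight [x 0 i * x 0 j] is symmetric in [i] and [j], so the two summation indices may be
    exchanged. *)
Lemma biquadratic_swapl (T : tensor43 R) x y :
  biquadratic (fun i j k l => T j i k l) x y = biquadratic T x y.
Proof.
rewrite /biquadratic exchange_big.
do 4![apply: eq_bigr => ? _]; ring.
Qed.

Lemma biquadratic_swapr (T : tensor43 R) x y :
  biquadratic (fun i j k l => T i j l k) x y = biquadratic T x y.
Proof.
rewrite /biquadratic; do 2![apply: eq_bigr => ? _].
rewrite exchange_big; do 2![apply: eq_bigr => ? _]; ring.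
Qed.

Lemma biquadratic_semi_paired x y :
  semi_paired_symmetric_of A B -> biquadratic A x y = biquadratic B x y.
Proof.
move=> hB; apply: (@mulfI _ 4%:R); first by rewrite pnatr_eq0.
have -> : 4%:R * biquadratic A x y =
    biquadratic (fun i j k l => B i j k l + B j i l k + B i j l k + B j i k l)
      x y.
  rewrite /biquadratic mulr_sumr; apply: eq_bigr => i _.
  rewrite mulr_sumr; apply: eq_bigr => j _.
  rewrite mulr_sumr; apply: eq_bigr => k _.
  rewrite mulr_sumr; apply: eq_bigr => l _.
  by have [_ _ ->] := hB i j k l; rewrite !mulrA.
(* The term [B j i l k] needs both swaps: this one turns it into [B i j l k]. *)
rewrite !biquadraticD (biquadratic_swapl (fun i j k l => B i j l k)).
rewrite (biquadratic_swapl (fun i j k l => B i j k l)).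
rewrite (biquadratic_swapr (fun i j k l => B i j k l)).
move: (biquadratic B x y) => b; ring.
Qed.

Definition bilinear_monomials (i j : 9.-tuple 'I_3) x y : 'cV[R]_9 :=
  \col_s (x 0 (tnth i s) * y 0 (tnth j s)).

Lemma distinct_pairs_bij (i j : 9.-tuple 'I_3) :
  distinct_pairs i j -> bijective (fun s : 'I_9 => (tnth i s, tnth j s)).
Proof. by move=> inj; apply: inj_card_bij => //; rewrite card_prod !card_ord. Qed.

Lemma biquadratic_unfolded (i j : 9.-tuple 'I_3) x y :
  distinct_pairs i j ->
  let z := bilinear_monomials i j x y in
  biquadratic B x y = (z^T *m unfolded_matrix B i j *m z) 0 0.
Proof.
move=> /distinct_pairs_bij bij /=.
(* [p] joins the first and third tensor indices, [q] the second and fourth: these are the pairs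
   carried by a row and a column of the unfolded matrix. *)
pose F (p q : 'I_3 * 'I_3) :=
  B p.1 q.1 p.2 q.2 * x 0 p.1 * x 0 q.1 * y 0 p.2 * y 0 q.2.
transitivity (\sum_p \sum_q F p q).
  rewrite -(pair_bigA _ (fun a k => \sum_q F (a, k) q)).
  apply: eq_bigr => a _ /=; rewrite exchange_big; apply: eq_bigr => k _ /=.
  by rewrite -(pair_bigA _ (fun b l => F (a, k) (b, l))).
rewrite (reindex _ (onW_bij _ bij)) mxE.
under eq_bigr => s _ do rewrite (reindex _ (onW_bij _ bij)).
rewrite exchange_big; apply: eq_bigr => t _; rewrite mxE mulr_suml.
by apply: eq_bigr => s _; rewrite !mxE /F /=; ring.
Qed.

(** Transposition swaps both index pairs at once, which is the first semi-paired relation. *)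
Lemma unfolded_matrix_sym (i j : 9.-tuple 'I_3) :
  semi_paired_symmetric_of A B -> unfolded_matrix B i j \is symmetricmx.
Proof.
move=> hB; apply/symmetricmxP/matrixP=> s t; rewrite !mxE.
by have [] := hB (tnth i t) (tnth i s) (tnth j t) (tnth j s).
Qed.

Lemma posdef_distinct_pairs (i j : 9.-tuple 'I_3) :
  mx_posdef (unfolded_matrix B i j) -> distinct_pairs i j.
Proof.
move=> posS s t [eq_i eq_j]; apply/eqP/negP=> /negP neq_st.
pose z : 'cV[R]_9 := delta_mx s 0 - delta_mx t 0.
have /posS : z != 0.
  apply/negP=> /eqP/colP/(_ s)/eqP.
  by rewrite !mxE !eqxx (negPf neq_st) subr0 oner_eq0.
rewrite -mulmxA mulmxBr -!colE.
have -> : col s (unfolded_matrix B i j) = col t (unfolded_matrix B i j).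
  by apply/colP=> p; rewrite !mxE eq_i eq_j.
by rewrite subrr mulmx0 mxE ltxx.
Qed.

(** Nonzero entries of [x] and [y], at [a] and [b], are multiplied at the position carrying
    [(a, b)]. *)
Lemma bilinear_monomials_neq0 (i j : 9.-tuple 'I_3) x y :
  distinct_pairs i j -> x != 0 -> y != 0 -> bilinear_monomials i j x y != 0.
Proof.
move=> /distinct_pairs_bij [g _ gK] /rV0Pn[a xa] /rV0Pn[b yb].
apply/negP=> /eqP/colP/(_ (g (a, b)))/eqP.
by rewrite !mxE; have [-> ->] := gK (a, b); rewrite mulf_eq0 (negPf xa) (negPf yb).
Qed.

(** Collects a linear form in the monomials into a coefficient matrix; each position contributes
    only to its own pair. *)
Lemma bilinear_form_of_monomials (i j : 9.-tuple 'I_3) (c : 'I_9 -> R) x y :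
  \sum_(a < 3) \sum_(b < 3)
    (\sum_p c p *+ ((tnth i p, tnth j p) == (a, b))) * x 0 a * y 0 b =
  \sum_p c p * bilinear_monomials i j x y p 0.
Proof.
rewrite (pair_bigA _ (fun a b =>
  (\sum_p c p *+ ((tnth i p, tnth j p) == (a, b))) * x 0 a * y 0 b)) /=.
under eq_bigr => q _ do rewrite !mulr_suml.
rewrite exchange_big; apply: eq_bigr => p _.
rewrite (bigD1 (tnth i p, tnth j p)) //= eqxx big1 ?addr0 => [|[a b] /negPf neq].
  by rewrite mxE mulr1n mulrA.
by rewrite eq_sym neq mulr0n !mul0r.
Qed.

End Biquadratic.

Theorem theorem5p6 (R : realType) (A B : tensor43 R)
    (hA : paired_symmetric A \/ elasticity_tensor A)
    (hB : semi_paired_symmetric_of A B)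
    (i j : 9.-tuple 'I_3) (hi : perm123123123 i) (hj : perm123123123 j) :
  [/\ unfolded_matrix B i j \is symmetricmx,
      distinct_pairs i j -> mx_psd (unfolded_matrix B i j) -> sos_bilinear A
    & mx_posdef (unfolded_matrix B i j) -> biquadratic_posdef A].
Proof.
have symS := unfolded_matrix_sym i j hB.
split=> // [dist psdS | posS x y x0 y0].
- have [L defS] := psd_factorization symS psdS.
  (* One square per column of [L], whose entries are placed at the pairs of their positions. *)
  exists 9, (fun s => \matrix_(a, b)
    \sum_p L p s *+ ((tnth i p, tnth j p) == (a, b))); split=> // x y.
  rewrite (biquadratic_semi_paired x y hB) (biquadratic_unfolded _ _ _ dist) defS.
  (* The form is [v *m v^T] for the row [v = z^T *m L], hence the sum of the squares of the entries
     of [v]. *)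
  rewrite mulmxA -mulmxA -[L^T *m _]trmxK trmx_mul trmxK mxE.
  apply: eq_bigr => s _; rewrite [_^T s 0]mxE -expr2; congr (_ ^+ 2).
  under eq_bigr => a _ do under eq_bigr => b _ do rewrite mxE.
  rewrite bilinear_form_of_monomials mxE.
  by apply: eq_bigr => p _; rewrite mxE mulrC.
- have dist := posdef_distinct_pairs posS.
  rewrite (biquadratic_semi_paired x y hB) (biquadratic_unfolded _ _ _ dist).
  by apply: posS; apply: bilinear_monomials_neq0.
Qed.
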